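(* (1) For every $\mathcal I\in\mathcal{AN}$ there exists $f\in\omega^\omega$ with $f(n)>0$ for all $n\ge1$ such that $\mathcal I\le_K\Phi(f)$. (2) For all $g,h\in\omega^\omega$ with $g(n),h(n)>0$ for all $n\ge1$, if $2n^2\cdot g(n)\le h(n)$ for all but finitely many $n\in\omega$, then $\Phi(g)\le_K\Phi(h)$.
   Context: For $f\in\omega^\omega$ with $f(n)>0$ for every $n\ge1$, let $\langle I_n:n\ge1\rangle$ be the partition of $\omega$ into consecutive intervals with $\min I_1=0$, $\min I_{n+1}=\max I_n+1$ and $|I_n|=n\cdot f(n)$, let $\mu^f_n$ be the measure on $\omega$ supported on $I_n$ giving mass $1/f(n)$ to each point of $I_n$ (so $\|\mu_n^f\|=n$), and let $\Phi(f)=\mathrm{Exh}(\sup_{n\ge1}\mu^f_n)=\{X\subseteq\omega:\lim_n\mu_n^f(X)=0\}$. For a free filter $F$, $N_F=\omega\cup\{p_F\}$ has points of $\omega$ isolated and neighbourhoods $A\cup\{p_F\}$, $A\in F$, of $p_F$; $F$ has the Nikodym property if there is no sequence of finitely supported measures $\sum_i\alpha_i\delta_{x_i}$ on $N_F$ with norms $\sum|\alpha_i|\to\infty$ and values on every clopen set tending to $0$. $\mathcal{AN}$ is the class of ideals on $\omega$ whose dual filter lacks the Nikodym property. $\mathcal I\le_K\mathcal J$ if some $f\colon\omega\to\omega$ has $f^{-1}[A]\in\mathcal J$ for all $A\in\mathcal I$. *)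

(* Defs.v *)
From HB Require Import structures.
From mathcomp Require Import all_boot all_order all_algebra.
From mathcomp Require Import finmap.
From mathcomp Require Import all_classical all_reals all_analysis.

Set Implicit Arguments.
Unset Strict Implicit.
Unset Printing Implicit Defensive.

Import Order.TTheory GRing.Theory Num.Theory.
Import numFieldNormedType.Exports.

Local Open Scope classical_set_scope.
Local Open Scope ring_scope.

(* As usual, ideals on omega are proper and contain all finite sets; dually,
   free filters are proper and contain all cofinite sets. *)
Record ideal := Ideal {
  ideal_set :> set (set nat);
  ideal_fin : forall A, finite_set A -> ideal_set A;
  ideal_sub : forall A B, A `<=` B -> ideal_set B -> ideal_set A;
  ideal_setU : forall A B, ideal_set A -> ideal_set B -> ideal_set (A `|` B);
  ideal_proper : ~ ideal_set setT }.

Record free_filter := FreeFilter {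
  free_filter_set :> set_system nat;
  free_filter_proper : ProperFilter free_filter_set;
  free_filter_cofin : forall A, finite_set A -> free_filter_set (~` A) }.

#[global] Existing Instance free_filter_proper.

Section DualFilter.
Variable I : ideal.

Definition dual_set : set_system nat := [set A | ideal_set I (~` A)].

Lemma dual_set_proper : ProperFilter dual_set.
Proof.
split; first by rewrite /dual_set /= setC0; exact: ideal_proper.
split; rewrite /dual_set /=.
- by rewrite setCT; apply: ideal_fin.
- by move=> A B IA IB /=; rewrite setCI; apply: ideal_setU.
- by move=> A B AB; apply: ideal_sub; apply: subsetC.
Qed.

Lemma dual_set_cofin A : finite_set A -> dual_set (~` A).
Proof. by move=> Af; rewrite /dual_set /= setCK; exact: ideal_fin. Qed.

Definition dual_filter : free_filter :=
  FreeFilter dual_set_proper dual_set_cofin.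
End DualFilter.

(* [Some n] is the point n of omega and [None] is the point p_F. *)
Definition N_ (F : free_filter) : Type := option nat.

Section SpaceNF.
Variable F : free_filter.

HB.instance Definition _ := Choice.on (N_ F).

Definition N_nbhs (x : N_ F) : set_system (N_ F) :=
  if x is Some n then [set U : set (N_ F) | U (Some n)]
  else [set U : set (N_ F) |
         exists2 A, free_filter_set F A & [set Some k | k in A] `|` [set None] `<=` U].

HB.instance Definition _ := hasNbhs.Build (N_ F) N_nbhs.

Let N_nbhs_filter (x : N_ F) : ProperFilter (nbhs x).
Proof.
case: x => [n|]; split; rewrite /nbhs /=; [by []|split| |split] => //=.
- by move=> P Q + PA; exact.
- by case=> A _ /(_ None); apply; right.
- by exists setT => //; exact: filterT.
- move=> P Q [A FA AP] [B FB BQ]; exists (A `&` B); first exact: filterI.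
  move=> _ [[k [Ak Bk] <-]|->]; split.
  + by apply: AP; left; exists k.
  + by apply: BQ; left; exists k.
  + by apply: AP; right.
  + by apply: BQ; right.
- by move=> P Q PQ [A FA AP]; exists A => //; exact: subset_trans PQ.
Qed.

Let N_nbhs_singleton (x : N_ F) (U : set (N_ F)) : nbhs x U -> U x.
Proof. by case: x => [n//|[A _]]; apply; right. Qed.

Let N_nbhs_nbhs (x : N_ F) (U : set (N_ F)) :
  nbhs x U -> nbhs x (nbhs^~ U).
Proof.
case: x => [n//|[A FA AU]]; exists A => // _ [[k Ak <-]|->].
- by apply: AU; left; exists k.
- by exists A.
Qed.

HB.instance Definition _ := Nbhs_isNbhsTopological.Build (N_ F)
  N_nbhs_filter N_nbhs_singleton N_nbhs_nbhs.
End SpaceNF.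

Section FiniteSupport.
Context {R : realType} {T : choiceType}.

(* The finitely supported function [mu] is the measure
   [\sum_x mu x * delta_x]. *)
Definition fs_value (mu : {fsfun T -> R with 0}) (A : set T) : R :=
  \sum_(x <- finsupp mu | x \in A) mu x.

Definition fs_norm (mu : {fsfun T -> R with 0}) : R :=
  \sum_(x <- finsupp mu) `|mu x|.
End FiniteSupport.

Definition nikodym (R : realType) (F : free_filter) : Prop :=
  ~ exists mu : nat -> {fsfun N_ F -> R with 0},
      fs_norm (mu n) @[n --> \oo] --> +oo /\
      forall A : set (N_ F), clopen A ->
        fs_value (mu n) A @[n --> \oo] --> (0 : R).

Definition AN (R : realType) : set ideal :=
  [set I | ~ nikodym R (dual_filter I)].

Definition katetov_le (I J : set (set nat)) : Prop :=
  exists f : nat -> nat, forall A, I A -> J (f @^-1` A).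

Section Phi.
Variables (R : realType) (f : nat -> nat).

Definition interval_min (n : nat) : nat := (\sum_(1 <= k < n) k * f k)%N.

(* The interval I_n is [interval_min n, interval_min n.+1[; see
   interval_minS for its length. *)
Definition mu_ (n : nat) (X : set nat) : R :=
  \sum_(interval_min n <= i < interval_min n.+1 | i \in X) (f n)%:R^-1.

Definition exh (phi : set nat -> \bar R) : set (set nat) :=
  [set X | phi (X `\` `I_m) @[m --> \oo] --> 0%E].

Definition Phi : set (set nat) :=
  exh (fun X => ereal_sup [set (mu_ n X)%:E | n in [set n | (1 <= n)%N]]).

Lemma interval_minS n :
  (1 <= n)%N -> interval_min n.+1 = (interval_min n + n * f n)%N.
Proof. by move=> n1; rewrite /interval_min big_nat_recr. Qed.

Lemma mu_ge0 n X : 0 <= mu_ n X.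
Proof. by apply: sumr_ge0 => i _; rewrite invr_ge0. Qed.

Lemma mu_le n X Y : X `<=` Y -> mu_ n X <= mu_ n Y.
Proof.
move=> XY; rewrite /mu_ big_mkcond [leRHS]big_mkcond /=.
apply: ler_sum => i _; case: ifPn => [|_].
- by rewrite inE => /XY Yi; rewrite mem_set.
- by case: ifP => // _; rewrite invr_ge0.
Qed.

Lemma interval_min_le m n :
  (m <= n)%N -> (interval_min m <= interval_min n)%N.
Proof.
move=> mn; rewrite -(subnKC mn); elim: (n - m)%N => [|k IH].
  by rewrite addn0.
rewrite addnS; apply: (leq_trans IH); case: (m + k)%N => [|l].
  by rewrite /interval_min big_geq.
by rewrite [leqRHS]interval_minS ?leq_addr.
Qed.

Lemma interval_min_ge n : (forall n, (1 <= n)%N -> (0 < f n)%N) ->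
  (n <= (interval_min n).+1)%N.
Proof.
move=> f0; elim: n => // -[//|n] IH; rewrite interval_minS //.
by rewrite -addn1 -addSn leq_add// muln_gt0 f0.
Qed.

Lemma PhiE : (forall n, (1 <= n)%N -> (0 < f n)%N) ->
  Phi = [set X | mu_ n X @[n --> \oo] --> (0 : R)].
Proof.
move=> f0; apply/seteqP; split=> X /=.
- move=> Xexh; apply/cvgrPdist_le => e e0.
  have /Xexh [m _ /(_ m (leqnn _)) /=] :
      nbhs (0 : \bar R) [set x | (x < e%:E)%E].
    apply: open_nbhs_nbhs; split; first exact: open_ereal_lt_ereal.
    by rewrite /= lte_fin.
  move=> supe.
  exists m.+2 => // n /= mn; rewrite sub0r normrN ger0_norm ?mu_ge0//.
  have -> : mu_ n X = mu_ n (X `\` `I_m).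
    rewrite /mu_ [LHS]big_nat_cond [RHS]big_nat_cond; apply: eq_bigl => i.
    apply: andb_id2l => /andP[ni _].
    apply/idP/idP; rewrite !inE /=; last by case.
    move=> Xi; split=> //; apply/negP; rewrite -leqNgt.
    by rewrite (leq_trans _ ni)// -ltnS (leq_trans (ltnW mn))// interval_min_ge.
  rewrite -lee_fin; apply: le_trans (ltW supe); apply: ereal_sup_ubound.
  by exists n => //=; rewrite (leq_trans _ mn).
- move=> /cvgrPdist_le Xmu; apply/fine_cvgP.
  have sup_le (e : R) : 0 < e -> \forall m \near \oo,
      (0 <= ereal_sup [set (mu_ n (X `\` `I_m))%:E | n in [set n | (1 <= n)%N]]
         <= e%:E)%E.
    move=> e0; have [N _ muN] := Xmu e e0.
    exists (interval_min N) => // m /= Nm; apply/andP; split.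
      apply: le_trans (_ : (mu_ 1 (X `\` `I_m))%:E <= _)%E.
        by rewrite lee_fin mu_ge0.
      by apply: ereal_sup_ubound; exists 1%N.
    apply: ge_ereal_sup => _ [n /= n1 <-]; rewrite lee_fin.
    have [Nn|nN] := leqP N n.
      have := muN n Nn; rewrite /= sub0r normrN ger0_norm ?mu_ge0//.
      by apply: le_trans; apply: mu_le; exact: subDsetl.
    rewrite /mu_ big_nat_cond big_pred0 ?ltW// => i.
    apply/negP => /andP[/andP[_ iN]]; rewrite inE => -[_]; apply => /=.
    by rewrite (leq_trans iN)// (leq_trans _ Nm)// interval_min_le.
  split.
    near=> m; have /andP[s0 s1] : (0 <= ereal_sup
        [set (mu_ n (X `\` `I_m))%:E | n in [set n | (1 <= n)%N]] <= 1%:E)%E.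
      by near: m; exact: sup_le.
    by rewrite ge0_fin_numE// (le_lt_trans s1)// ltry.
  apply/cvgrPdist_le => e e0; near=> m.
  have /andP[s0 se] : (0 <= ereal_sup
      [set (mu_ n (X `\` `I_m))%:E | n in [set n | (1 <= n)%N]] <= e%:E)%E.
    by near: m; exact: sup_le.
  rewrite /= sub0r normrN ger0_norm ?fine_ge0// -lee_fin fineK//.
  by rewrite ge0_fin_numE// (le_lt_trans se)// ltry.
Unshelve. all: by end_near. Qed.
End Phi.

(* Main.v *)
Require Import Defs.
From mathcomp Require Import all_boot all_order all_algebra finmap.
From mathcomp Require Import all_classical all_reals all_analysis.
From mathcomp Require Import lra.

(** On a clopen set [Some @` A] with A in the ideal I, the measures mu_k witnessing
the failure of the Nikodym property tend to 0 at every subset, so Schur's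
gliding hump argument gives |mu_k|(A) -> 0.  Since mu_k(N_F) -> 0, the point
p_F carries at most about half of the norm, so |mu_k|(omega) -> oo.  Pick k_n
with |mu_{k_n}|(omega) >= n + 1; for f(n) large, I_n can be mapped to omega so
that mu^f_n is pushed forward to a measure below |mu_{k_n}|.

For (2), map I_n(h) onto I_n(g) modulo |I_n(g)|: the pushforward of mu^h_n is at
most 2 mu^g_n. *)

Set Implicit Arguments.
Unset Strict Implicit.
Unset Printing Implicit Defensive.

Import Order.TTheory GRing.Theory Num.Theory.
Import numFieldNormedType.Exports.

Local Open Scope classical_set_scope.
Local Open Scope ring_scope.

(** Both sums extend by zero terms to the union of [K] and [L]. This allows trading [finsupp mu] for
    a more convenient finite set. *)
Lemma eq_big_fset_supp (V : nmodType) (T : choiceType) (F : T -> V)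
    (K L : {fset T}) :
  (forall x, F x != 0 -> (x \in K) = (x \in L)) ->
  \sum_(x <- K) F x = \sum_(x <- L) F x.
Proof.
move=> KL; have sub (M N : {fset T}) : (forall x, F x != 0 -> x \in N -> x \in M) ->
    \sum_(x <- M) F x = \sum_(x <- (M `|` N)%fset) F x.
  move=> NM; apply: big_fset_incl; first exact: fsubsetUl.
  move=> x; rewrite inE => /orP[->//|xN] xM; apply/eqP; apply: contraNT xM.
  by move=> /NM; apply.
rewrite (sub K L) ?(sub L K) 1?fsetUC//.
- by move=> x Fx; rewrite KL.
- by move=> x Fx; rewrite KL.
Qed.

(** * Variation of finitely supported measures and Schur's theorem *)

Section Schur.
Context {R : realType} {T : choiceType}.
Implicit Types (mu : {fsfun T -> R with 0}) (A B : set T).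

Definition fs_variation mu A : R := \sum_(x <- finsupp mu | x \in A) `|mu x|.

Lemma fs_variation_ge0 mu A : 0 <= fs_variation mu A.
Proof. exact: sumr_ge0. Qed.

Lemma fs_value_set1 mu x : fs_value mu [set x] = mu x.
Proof.
rewrite /fs_value big_mkcond (@eq_big_fset_supp _ _ _ _ [fset x]%fset).
  by rewrite big_seq_fset1 mem_set.
move=> y; case: ifPn => [|_]; last by rewrite eqxx.
by rewrite in_setE => /= ->; rewrite mem_finsupp inE eqxx.
Qed.

Lemma fs_value_le_variation mu A : `|fs_value mu A| <= fs_variation mu A.
Proof. exact: ler_norm_sum. Qed.

Lemma fs_value_setID mu A B :
  fs_value mu A = fs_value mu (A `&` B) + fs_value mu (A `\` B).
Proof.
rewrite /fs_value big_mkcond [X in _ = X + _]big_mkcond.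
rewrite [X in _ = _ + X]big_mkcond -big_split; apply: eq_bigr => x _.
by rewrite in_setI in_setD; case: (x \in A); case: (x \in B); rewrite /= ?addr0 ?add0r.
Qed.

Lemma fs_variation_setID mu A B :
  fs_variation mu A = fs_variation mu (A `&` B) + fs_variation mu (A `\` B).
Proof.
rewrite /fs_variation big_mkcond [X in _ = X + _]big_mkcond.
rewrite [X in _ = _ + X]big_mkcond -big_split; apply: eq_bigr => x _.
by rewrite in_setI in_setD; case: (x \in A); case: (x \in B); rewrite /= ?addr0 ?add0r.
Qed.

Lemma eq_fs_value mu A B :
  A `&` [set` finsupp mu] = B `&` [set` finsupp mu] ->
  fs_value mu A = fs_value mu B.
Proof.
move=> AB; rewrite /fs_value big_seq_cond [RHS]big_seq_cond; apply: eq_bigl => x.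
apply: andb_id2l => xmu; have := f_equal (fun C => x \in C) AB.
by rewrite !in_setI (mem_set (xmu : [set` finsupp mu] x)) !andbT.
Qed.

Lemma le_fs_variation mu A B : A `<=` B -> fs_variation mu A <= fs_variation mu B.
Proof.
move=> AB; rewrite (fs_variation_setID mu B A).
by rewrite (_ : B `&` A = A) ?lerDl ?fs_variation_ge0//; apply/setIidPr.
Qed.

(* One of the positive and negative parts carries at least half of the
   variation. *)
Lemma half_variation mu A : exists2 B, B `<=` A `&` [set` finsupp mu] &
  fs_variation mu A <= 2 * `|fs_value mu B|.
Proof.
pose P := A `&` [set` finsupp mu] `&` [set x | 0 < mu x].
pose N := A `&` [set` finsupp mu] `&` [set x | mu x < 0].
have split_var : fs_variation mu A = fs_value mu P - fs_value mu N.
  rewrite /fs_variation /fs_value -sumrN big_mkcond [X in _ = X + _]big_mkcond.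
  rewrite [X in _ = _ + X]big_mkcond -big_split; apply: eq_big_seq => x xmu /=.
  have xE (Q : set T) : (x \in A `&` [set` finsupp mu] `&` Q) = (x \in A) && (x \in Q).
    by rewrite !in_setI (mem_set (xmu : [set` finsupp mu] x)) andbT.
  rewrite !xE; case: (x \in A) => /=; last by rewrite addr0.
  have inB (b : T -> bool) : (x \in [set y | b y]) = b x.
    by apply/idP/idP; rewrite in_setE.
  rewrite !inB; have [m0|m0|->] := ltgtP (mu x) 0.
  - by rewrite ltr0_norm// add0r.
  - by rewrite gtr0_norm// addr0.
  - by rewrite normr0 addr0.
have [PN|NP] := leP `|fs_value mu N| `|fs_value mu P|.
- exists P; first by move=> x [].
  rewrite split_var; apply: le_trans (ler_norm _) _.
  by apply: le_trans (ler_normB _ _) _; lra.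
- exists N; first by move=> x [].
  rewrite split_var; apply: le_trans (ler_norm _) _.
  by apply: le_trans (ler_normB _ _) _; lra.
Qed.

(** Only finitely many point masses are involved, and each tends to 0 because the singletons of
    points of [A] are among the sets [B]. In the gliding hump this makes the part already used
    negligible. *)
Lemma fs_variation_cvg_fset (mu : nat -> {fsfun T -> R with 0}) A
    (S : {fset T}) :
  (forall B, B `<=` A -> fs_value (mu n) B @[n --> \oo] --> (0 : R)) ->
  fs_variation (mu n) (A `&` [set` S]) @[n --> \oo] --> (0 : R).
Proof.
move=> muA.
have -> : (fun n => fs_variation (mu n) (A `&` [set` S])) =
          (fun n => \sum_(x <- S | x \in A) `|mu n x|).
  apply/funext => n; rewrite /fs_variation big_mkcond [RHS]big_mkcond.
  under eq_bigr do rewrite in_setI mem_setE if_and.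
  rewrite (@eq_big_fset_supp _ _ _ _ S); last first.
    move=> x; case: ifP => _; last by rewrite eqxx.
    by case: ifP; rewrite ?eqxx// normr_eq0 mem_finsupp => _ ->.
  by apply: eq_big_seq => x /= ->.
suff sumS (s : seq T) : \sum_(x <- s | x \in A) `|mu n x| @[n --> \oo] --> (0 : R).
  exact: sumS.
elim: s => [|x s IH].
  by under eq_cvg do rewrite big_nil; exact: cvg_cst.
under eq_cvg do rewrite big_cons.
case xA: (x \in A) => //.
have /cvg_norm : mu n x @[n --> \oo] --> (0 : R).
  under eq_cvg do rewrite -fs_value_set1.
  by apply: muA => _ ->; rewrite -in_setE.
by rewrite normr0 => /cvgD /(_ IH); rewrite addr0.
Qed.

(* Gliding hump: were the variations not to vanish, one could choose [n j]
   and disjoint finite [B j] with [fs_value (mu (n j)) (B j)] large and the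
   earlier [B i] almost null for [mu (n j)]; the union of the [B j] would then
   be a counterexample. *)
Lemma schur (mu : nat -> {fsfun T -> R with 0}) A :
  (forall B, B `<=` A -> fs_value (mu n) B @[n --> \oo] --> (0 : R)) ->
  fs_variation (mu n) A @[n --> \oo] --> (0 : R).
Proof.
move=> muA; apply/cvgrPdist_lt => e e0; apply: contrapT => nlim.
have large N : exists2 n, (N <= n)%N & e <= fs_variation (mu n) A.
  apply: contrapT => nex; apply: nlim; exists N => // n /= Nn.
  rewrite sub0r normrN ger0_norm ?fs_variation_ge0// ltNge.
  by apply/negP => en; apply: nex; exists n.
(* From the used points and a lower bound for the index, [p], to the new index and hump, [q]. A
   variation of at least e on [A], less than e/8 of it on the used points, leaves 7e/8; half of that
   exceeds 3e/8. *)
have hump (p : {fset T} * nat) : exists q : nat * set T,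
    [/\ (p.2 <= q.1)%N, q.2 `<=` (A `\` [set` p.1]) `&` [set` finsupp (mu q.1)],
        fs_variation (mu q.1) (A `&` [set` p.1]) < e / 8 &
        e * 3 / 8 <= `|fs_value (mu q.1) q.2|].
  case: p => S N /=; have e8 : 0 < e / 8 by lra.
  have /cvgrPdist_lt/(_ _ e8) [M _ MS] := @fs_variation_cvg_fset mu A S muA.
  have [n Mn en] := large (maxn M N).
  have [B BA nB] := half_variation (mu n) (A `\` [set` S]).
  have := MS n (leq_trans (leq_maxl _ _) Mn).
  rewrite /= sub0r normrN ger0_norm ?fs_variation_ge0// => nS.
  exists (n, B); split => //=; first exact: leq_trans (leq_maxr _ _) Mn.
  move: en; rewrite (fs_variation_setID _ A [set` S]) => en; lra.
have [step stepP] := choice hump.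
(* [S j] collects the supports of the measures chosen before stage [j]. Passing [j] as the lower
   bound gives [j <= n j]. *)
pose S := fix S j := if j is i.+1
  then (S i `|` finsupp (mu (step (S i, i)).1))%fset else fset0.
pose n j := (step (S j, j)).1; pose B j := (step (S j, j)).2.
have SS j : S j.+1 = (S j `|` finsupp (mu (n j)))%fset by [].
have S_le i j : (i <= j)%N -> (S i `<=` S j)%fset.
  elim: j => [|j IH]; first by rewrite leqn0 => /eqP ->.
  rewrite leq_eqVlt => /orP[/eqP ->//|/IH ij].
  by rewrite SS; apply: fsubset_trans ij (fsubsetUl _ _).
have BP j : B j `<=` (A `\` [set` S j]) `&` [set` finsupp (mu (n j))].
  by have [] := stepP (S j, j).
have UA : \bigcup_j B j `<=` A by move=> x [j _ /BP[[]]].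
have /cvgrPdist_lt/(_ (e / 8)) := muA _ UA.
case; first by lra.
move=> M _ /(_ (n M)); have [/= Mn _ nS nB] := stepP (S M, M).
move/(_ Mn); rewrite /= sub0r normrN (fs_value_setID _ _ (B M)).
rewrite (_ : _ `&` B M = B M); last by apply/setIidPr; exact: bigcup_sup.
(* For [mu (n M)] the other humps count only inside [S M]: earlier ones lie in it, and later ones
   avoid the support of [mu (n M)]. *)
rewrite (@eq_fs_value _ (_ `\` _) ((\bigcup_j B j `\` B M) `&` [set` S M])); last first.
  apply/seteqP; split=> x [xU xmu]; last by case: xU.
  split=> //; split=> //; case: xU => -[j _ xj] nxM.
  have [ltj|ltM|jM] := ltngtP j M; last by rewrite jM in xj.
  - apply: (fsubsetP (S_le _ _ ltj)); rewrite SS inE.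
    by case: (BP j x xj) => _ /= ->; rewrite orbT.
  - case: (BP j x xj) => -[_ []] /=.
    by apply: (fsubsetP (S_le _ _ ltM)); rewrite SS inE; rewrite /n xmu orbT.
set v := fs_value _ (_ `&` _) => Uv.
have vS : `|v| < e / 8.
  apply: le_lt_trans nS; apply: le_trans (fs_value_le_variation _ _) _.
  by apply: le_fs_variation => x [[/UA]].
(* The value on the union would be at least 3e/8 - e/8 in modulus, yet it is below e/8. *)
have := lerB_normD (fs_value (mu (n M)) (B M)) v.
rewrite -/(n M) -/(B M) in nB Uv; lra.
Qed.
End Schur.

(** * Maps defined interval by interval, and Katetov reductions to [Phi] *)

Lemma interval_concat (f : nat -> nat) (a : nat -> nat -> nat) :
  exists phi : nat -> nat, forall n j, (1 <= n)%N -> (j < n * f n)%N ->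
    phi (interval_min f n + j)%N = a n j.
Proof.
have ex m : exists y, forall n j, (1 <= n)%N -> (j < n * f n)%N ->
    m = (interval_min f n + j)%N -> y = a n j.
  have [[n [j [n1 jn mE]]]|no] := pselect (exists n j, [/\ (1 <= n)%N,
      (j < n * f n)%N & m = (interval_min f n + j)%N]); last first.
    by exists 0%N => n j n1 jn mE; exfalso; apply: no; exists n, j.
  exists (a n j) => n' j' n1' jn' mE'.
  (* Disjointness of the intervals makes the pair (n, j) unique, so the value [a n j] is well
     defined. *)
  have not_lt p q i k : (1 <= p)%N -> (i < p * f p)%N -> (p < q)%N ->
      (interval_min f p + i)%N <> (interval_min f q + k)%N.
    move=> p1 ip /(interval_min_le f); rewrite interval_minS// => le_pq eq_pq.
    move: le_pq; rewrite -(leq_add2r k) -eq_pq leqNgt => /negP; apply.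
    by rewrite -addnA ltn_add2l (leq_trans ip)// leq_addr.
  have [nn'|n'n|nn'] := ltngtP n n'.
  - by case: (not_lt n n' j j'); rewrite // -mE.
  - by case: (not_lt n' n j' j); rewrite // -mE'.
  - by move: mE'; rewrite mE -nn' => /addnI ->.
have [phi phiP] := choice ex.
by exists phi => n j n1 jn; exact: (phiP _ n j).
Qed.

Section KatetovPhi.
Variable R : realType.

Lemma mu_count f n X : (1 <= n)%N -> mu_ R f n X =
  (count (fun j => (interval_min f n + j)%N \in X) (iota 0 (n * f n)))%:R / (f n)%:R.
Proof.
move=> n1; rewrite /mu_ interval_minS// -{1}[interval_min f n]add0n big_addn addKn.
rewrite big_const_seq iter_addr_0 /index_iota subn0 mulr_natl.
by congr (_ *+ _); apply: eq_count => j; rewrite addnC.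
Qed.

Lemma mu_preimage f (a : nat -> nat -> nat) phi n A : (1 <= n)%N ->
  (forall j, (j < n * f n)%N -> phi (interval_min f n + j)%N = a n j) ->
  mu_ R f n (phi @^-1` A) =
  (count (fun j => a n j \in A) (iota 0 (n * f n)))%:R / (f n)%:R.
Proof.
move=> n1 phiE; rewrite mu_count//; congr (_%:R / _).
apply: eq_in_count => j; rewrite mem_iota add0n => /phiE <-.
by apply/idP/idP; rewrite !in_setE.
Qed.

(** Rounding [N] up to a multiple of [m] only adds points, and every full period contributes the
    same count. *)
Lemma count_modn_iota (P : pred nat) m N : (0 < m)%N ->
  (count (fun j => P (j %% m)) (iota 0 N) <= (N %/ m).+1 * count P (iota 0 m))%N.
Proof.
move=> m0.
have countM Q : count (fun j => P (j %% m)%N) (iota 0 (Q * m)) =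
    (Q * count P (iota 0 m))%N.
  elim: Q => // Q IH; rewrite !mulSnr iotaD count_cat IH; congr addn.
  rewrite add0n -[X in iota X]addn0 iotaDl.
  rewrite count_map; apply: eq_in_count => j; rewrite mem_iota add0n => jm /=.
  by rewrite modnMDl modn_small.
rewrite -countM; have /subnKC <- : (N <= (N %/ m).+1 * m)%N by exact/ltnW/ltn_ceil.
by rewrite iotaD count_cat leq_addr.
Qed.

(** Under reduction modulo [n * g n] a point has at most [(h n %/ g n).+1] preimages. Since [(h n %/
    g n).+1 * g n <= h n + g n <= 2 * h n], the factor 2 results. *)
Lemma Phi_katetov_le (g h : nat -> nat) :
  (forall n, (1 <= n)%N -> (0 < g n)%N) ->
  (forall n, (1 <= n)%N -> (0 < h n)%N) ->
  (\forall n \near \oo, (g n <= h n)%N) ->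
  katetov_le (Phi R g) (Phi R h).
Proof.
move=> g0 h0 gh.
have [phi phiE] :=
  interval_concat h (fun n j => interval_min g n + j %% (n * g n))%N.
exists phi => A; rewrite !PhiE//= => gA.
have gA2 : 2 * mu_ R g n A @[n --> \oo] --> (0 : R).
  by rewrite -(mulr0 (2 : R)); exact: cvgMr.
apply: (squeeze_cvgr _ (cvg_cst (0 : R)) gA2).
near=> n; rewrite mu_ge0/=.
have n1 : (1 <= n)%N by near: n; exact: nbhs_infty_ge.
have ghn : (g n <= h n)%N by near: n.
rewrite (@mu_preimage h (fun n j => interval_min g n + j %% (n * g n))%N phi) ?mu_count //; last by move=> j; exact: phiE.
set c := count _ (iota 0 (n * g n)).
have g1 := g0 n n1; have h1 := h0 n n1.
have := @count_modn_iota (fun j => (interval_min g n + j)%N \in A) (n * g n)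
  (n * h n); rewrite muln_gt0 n1 g1 => /(_ isT); rewrite divnMl// -/c => countle.
rewrite mulrA ler_pdivrMr ?ltr0n// mulrAC ler_pdivlMr ?ltr0n//.
rewrite -!natrM ler_nat (leq_trans (leq_mul countle (leqnn _)))//.
rewrite mulnAC (leq_trans (leq_mul (_ : _ <= 2 * h n)%N (leqnn c)))//.
  by rewrite mulSn addnC mul2n -addnn leq_add// leq_trunc_div.
by rewrite mulnAC.
Unshelve. all: by end_near. Qed.

(* [f n] is so large that rounding [f n * w n x] down loses at most [f n]
   points in total, so that enough room remains to push [mu_ f n] forward to a
   measure below [w n]. *)
Lemma katetov_le_Phi (I : set (set nat)) (s : nat -> seq nat)
    (w : nat -> nat -> R) :
  (forall n x, 0 <= w n x) ->
  (forall n, n.+1%:R <= \sum_(x <- s n) w n x) ->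
  (forall A, I A -> \sum_(x <- s n | x \in A) w n x @[n --> \oo] --> (0 : R)) ->
  exists2 f : nat -> nat, (forall n, (1 <= n)%N -> (0 < f n)%N) &
    katetov_le I (Phi R f).
Proof.
move=> w0 ws wA; pose f n := (size (s n)).+1.
pose c n x := Num.truncn ((f n)%:R * w n x).
have fw0 n x : 0 <= (f n)%:R * w n x by rewrite mulr_ge0.
(* The list of values for the n-th interval: [x] is repeated [c n x] times, so its preimage has mass
   at most [c n x / f n <= w n x] if [x] occurs once in [s n]. *)
pose t n := flatten [seq nseq (c n x) x | x <- s n].
have count_t n (P : pred nat) : count P (t n) = (\sum_(x <- s n | P x) c n x)%N.
  rewrite count_flatten sumnE !big_map [RHS]big_mkcond.
  by apply: eq_bigr => x _; rewrite count_nseq; case: (P x); rewrite ?mul1n.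
(* Before rounding the total is at least [n.+1 * f n]; rounding costs at most [size (s n) < f n]. *)
have size_t n : (n * f n <= size (t n))%N.
  rewrite -count_predT count_t -(leq_add2r (size (s n))) -(ler_nat R).
  rewrite [X in _ <= X]natrD natr_sum -[size (s n)]sum1_size natr_sum -big_split /=.
  apply: (@le_trans _ _ (\sum_(x <- s n) (f n)%:R * w n x)); last first.
    by apply: ler_sum => x _; rewrite -mulrSr ltW//; case/andP: (truncn_itv (fw0 n x)).
  rewrite -mulr_sumr sum1_size; apply: le_trans (ler_wpM2l _ (ws n)) => //.
  by rewrite -natrM ler_nat mulnS addnC leq_add// ?leqnSn// mulnC.
(* By [size_t] the default 0 is never read on the n-th interval. *)
exists f => //; have [phi phiE] := interval_concat f (fun n j => nth 0%N (t n) j).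
exists phi => A /wA wA0; rewrite PhiE//=.
apply: (squeeze_cvgr _ (cvg_cst (0 : R)) wA0).
near=> n; rewrite mu_ge0/=.
have n1 : (1 <= n)%N by near: n; exact: nbhs_infty_ge.
rewrite (@mu_preimage f (fun n j => nth 0%N (t n) j) phi) //; last by move=> j; exact: phiE.
rewrite ler_pdivrMr ?ltr0n//.
rewrite (@eq_count _ _ (preim (nth 0%N (t n)) (fun x => x \in A)))//.
rewrite -count_map map_nth_iota0//.
apply: (@le_trans _ _ (count (fun x => x \in A) (t n))%:R).
  by rewrite ler_nat -[t n in leqRHS](cat_take_drop (n * f n)) count_cat leq_addr.
rewrite count_t natr_sum mulrC mulr_sumr; apply: ler_sum => x _.
by rewrite truncn_le.
Unshelve. all: by end_near. Qed.
End KatetovPhi.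

(** * Clopen sets and finitely supported measures on N_F *)

Section FiniteSupportNF.
Context {R : realType} {F : free_filter}.
Implicit Type mu : {fsfun N_ F -> R with 0}.

(** [B] is open because it misses p_F; its complement is open because it contains the neighbourhood
    of p_F given by the complement of [A]. *)
Lemma clopen_omega (B : set (N_ F)) (A : set nat) :
  free_filter_set F (~` A) -> B `<=` Some @` A -> clopen B.
Proof.
move=> FA BA; split.
  by rewrite openE => -[n//|/BA[]].
rewrite -openC openE => -[n//|_]; exists (~` A) => //.
move=> _ [[k nAk <-]|->] /BA; last by case.
by case=> k' Ak' [kk']; apply: nAk; rewrite -kk'.
Qed.

Definition fs_points mu : seq nat := pmap id (finsupp mu : seq (option nat)).

Lemma fs_variation_points mu (A : set nat) :
  fs_variation mu (Some @` A : set (N_ F)) =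
  \sum_(x <- fs_points mu | x \in A) `|mu (Some x)|.
Proof.
rewrite [RHS]big_mkcond big_pmap /fs_variation [LHS]big_mkcond; apply: eq_bigr => -[x|] _ /=.
  rewrite (_ : (_ \in _) = (x \in A))//; apply/idP/idP; rewrite !in_setE.
    by case=> y Ay [<-].
  by exists x.
by case: ifPn => //; rewrite in_setE => -[].
Qed.

(** The mass at p_F is the total value minus the value on omega, so its modulus is at most that of
    the total value plus the variation on omega. *)
Lemma fs_norm_le mu :
  fs_norm mu <= 2 * fs_variation mu (range Some) + `|fs_value mu setT|.
Proof.
have -> : fs_norm mu = fs_variation mu setT.
  by rewrite /fs_norm /fs_variation; apply: eq_bigl => x; rewrite in_setT.
rewrite (fs_variation_setID _ _ (range Some)) (fs_value_setID _ _ (range Some)).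
have -> : setT `\` range Some = [set None] :> set (N_ F).
  apply/seteqP; split=> [[n [_ []]|//]|_ ->]; first by exists n.
  by split=> // -[].
rewrite setTI fs_value_set1.
have -> : fs_variation mu [set None] = `|mu None|.
  rewrite /fs_variation big_mkcond (@eq_big_fset_supp _ _ _ _ [fset (None : N_ F)]%fset).
    by rewrite big_seq_fset1 mem_set.
  move=> y; case: ifPn => [|_]; last by rewrite eqxx.
  by rewrite in_setE normr_eq0 => /= ->; rewrite mem_finsupp inE eqxx.
have := fs_value_le_variation mu (range Some).
have := lerB_normD (mu None) (fs_value mu (range Some)).
rewrite [mu None + _]addrC; lra.
Qed.
End FiniteSupportNF.

Lemma AN_katetov_le_Phi (R : realType) (I : ideal) : AN R I ->
  exists2 f : nat -> nat, (forall n, (1 <= n)%N -> (0 < f n)%N) &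
    katetov_le I (Phi R f).
Proof.
move=> /contrapT[mu [norm_mu mu0]].
have varA A : ideal_set I A ->
    fs_variation (mu n) (Some @` A : set (N_ (dual_filter I))) @[n --> \oo] --> (0 : R).
  move=> IA; apply: schur => B BA; apply: mu0.
  by apply: clopen_omega BA; rewrite /= /dual_set /= setCK.
(* The bound [n <= k] keeps the limits from [varA] valid along the chosen indices. *)
have var_large n : exists k, (n <= k)%N /\
    n.+1%:R <= fs_variation (mu k) (range Some : set (N_ (dual_filter I))).
  have /cvgrPdist_lt/(_ 1 ltr01) mu1 := mu0 _ clopenT.
  (* In [fs_norm_le] the summand 1 absorbs the total value, which is eventually below 1 in modulus,
     and 2 is the factor of the variation. *)
  move/cvgryPge: norm_mu => /(_ (2 * n.+1%:R + 1)) norm_mu.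
  near \oo => k; exists k; split; first by near: k; exact: nbhs_infty_ge.
  have : `|0 - fs_value (mu k) setT| < 1 by near: k.
  have : 2 * n.+1%:R + 1 <= fs_norm (mu k) by near: k.
  rewrite sub0r normrN; have := fs_norm_le (mu k); lra.
have [k kP] := choice var_large.
apply: (@katetov_le_Phi _ _ (fun n => fs_points (mu (k n)))
  (fun n x => `|mu (k n) (Some x)|)) => //.
- move=> n; have [_] := kP n; rewrite fs_variation_points.
  by under eq_bigl do rewrite in_setT.
- move=> A /varA /cvgrPdist_lt muA; apply/cvgrPdist_lt => e /muA[M _ MA].
  exists M => // n /= Mn; rewrite -fs_variation_points; apply: MA.
  by have [nk _] := kP n; exact: leq_trans Mn nk.
Unshelve. all: by end_near. Qed.

Theorem mainTheorem14 (R : realType) :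
  (forall I : ideal, AN R I ->
     exists2 f : nat -> nat, (forall n, (1 <= n)%N -> (0 < f n)%N) &
       katetov_le I (Phi R f)) /\
  (forall g h : nat -> nat,
     (forall n, (1 <= n)%N -> (0 < g n)%N) ->
     (forall n, (1 <= n)%N -> (0 < h n)%N) ->
     (\forall n \near \oo, (2 * n ^ 2 * g n <= h n)%N) ->
     katetov_le (Phi R g) (Phi R h)).
Proof.
split; first exact: AN_katetov_le_Phi.
move=> g h g0 h0 gh; apply: Phi_katetov_le => //.
near=> n; have n1 : (1 <= n)%N by near: n; exact: nbhs_infty_ge.
have : (2 * n ^ 2 * g n <= h n)%N by near: n.
by apply: leq_trans; rewrite leq_pmull// muln_gt0 expn_gt0 n1.
Unshelve. all: by end_near. Qed.
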